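(* Let $n\ge 0$ and let $\mathbf{A}$ be a set partition of $[n]$ with $r$ parts. Let $\Gamma'(r)$ denote the set of set compositions $\gamma=(\gamma_1,\dots,\gamma_s)$ of $[r]$ with $1\in\gamma_1$, and put $$p(\mathbf{A}) := \sum_{\gamma\in\Gamma'(r)} (-1)^{\ell(\gamma)-1}\,\gamma[\mathbf{A}]\ \in\ \mathrm{NCSym}.$$ If $\mathbf{A}$ is atomic, then $p(\mathbf{A})$ is a nonzero primitive element of the Hopf algebra $\mathrm{NCSym}$. If $\mathbf{A}$ is not atomic, then $p(\mathbf{A})=0$.
   Context: Let $\mathbb{P}$ be the set of positive integers, $[n]=\{1,\dots,n\}$ and $[0]=\emptyset$. Set partitions. A set partition of a finite set $X\subseteq\mathbb{P}$ is a set $\mathbf{A}=\{A_1,\dots,A_r\}$ of nonempty, pairwise disjoint subsets (parts) of $X$ with union $X$. Parts are always indexed in increasing order of their minimum elements. The empty set has a unique set partition, denoted $\boldsymbol{\emptyset}$ (with $r=0$ parts). Let $\Pi(n)$ be the set of set partitions of $[n]$. For a set partition $\mathbf{A}$ with $r$ parts and $K\subseteq[r]$, let $\mathbf{A}_K=\{A_k\mid k\in K\}$. For a set partition $\mathbf{A}$ of an $n$-element set $X$, its standardization $\mathbf{A}^{\downarrow}\in\Pi(n)$ is the pullback of $\mathbf{A}$ along the unique increasing bijection $[n]\to X$. For $\mathbf{B}\in\Pi(m)$ and $\mathbf{C}\in\Pi(n)$, $\mathbf{B}|\mathbf{C}\in\Pi(m+n)$ is the set partition $\mathbf{B}\cup\mathbf{C}^{+m}$,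 where $\mathbf{C}^{+m}$ is obtained from $\mathbf{C}$ by adding $m$ to every element of every part. Atomic. A set partition $\mathbf{A}$ of $[n]$, $n\ge1$, is atomic if there do not exist a subset $\mathbf{B}\subseteq\mathbf{A}$ and an integer $1\le m<n$ such that $\mathbf{B}$ is a set partition of $[m]$ (equivalently, $\mathbf{A}$ is not of the form $\mathbf{B}|\mathbf{C}$ with $\mathbf{B}\in\Pi(n')$, $\mathbf{C}\in\Pi(n'')$, $n',n''\ge1$). The empty partition $\boldsymbol{\emptyset}$ is not regarded as atomic. Set compositions. A set composition of a finite set $K\subseteq\mathbb{P}$ is a sequence $\gamma=(\gamma_1,\dots,\gamma_s)$ of nonempty, pairwise disjoint subsets of $K$ with union $K$; its length is $\ell(\gamma)=s$. If $\mathbf{A}$ is a set partition with $r$ parts and $\gamma=(\gamma_1,\dots,\gamma_s)$ is a set composition of some $K\subseteq[r]$, define $$\gamma[\mathbf{A}] := (\mathbf{A}_{\gamma_1})^{\downarrow}\,|\,(\mathbf{A}_{\gamma_2})^{\downarrow}\,|\,\cdots\,|\,(\mathbf{A}_{\gamma_s})^{\downarrow}.$$ The Hopf algebra. $\mathrm{NCSym}=\bigoplus_{n\ge0}\mathrm{NCSym}_n$ is the graded $\mathbb{Q}$-vector space where $\mathrm{NCSym}_n$ has basis $\Pi(n)$. It is a graded connected cocommutative Hopf algebra with product $\mathbf{A}\cdot\mathbf{B}=\mathbf{A}|\mathbf{B}$, unit $\boldsymbol{\emptyset}$, coproduct $$\Delta(\mathbf{A})=\sum_{(K,L)} (\mathbf{A}_K)^{\downarrow}\otimes(\mathbf{A}_L)^{\downarrow}$$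 for $\mathbf{A}$ with $r$ parts, the sum being over ordered pairs $(K,L)$ of (possibly empty) subsets with $K\cup L=[r]$, $K\cap L=\emptyset$, and counit $\varepsilon(\mathbf{A})=0$ for $\mathbf{A}\ne\boldsymbol{\emptyset}$, $\varepsilon(\boldsymbol{\emptyset})=1$. An element $p$ is primitive if $\Delta(p)=p\otimes1+1\otimes p$. *)

(* Defs.v *)
From HB Require Import structures.
From mathcomp Require Import all_boot all_order all_algebra.
From mathcomp Require Import finmap monalg.

Set Implicit Arguments.
Unset Strict Implicit.
Unset Printing Implicit Defensive.

Import GRing.Theory.
Local Open Scope ring_scope.

(* The set [n] = {1, ..., n} is modelled by 'I_n, the integer i + 1 being     *)
(* represented by the ordinal of value i.                                     *)

Record setpart (n : nat) := SetPart {
  parts :> {set {set 'I_n}};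
  partsP : partition parts [set: 'I_n]
}.

HB.instance Definition _ n := [isSub for @parts n].
HB.instance Definition _ n := [Choice of setpart n by <:].

(* The disjoint union of the sets of set partitions of [n], for n : nat.      *)
Definition spart : Type := {n : nat & setpart n}.
HB.instance Definition _ := Choice.on spart.

Definition to_spart n (A : setpart n) : spart := Tagged setpart A.

Definition part_min n (X : {set 'I_n}) : nat := \big[minn/n]_(i in X) i.

(* The parts are indexed by 'I_r rather than [r], so the first part is        *)
(* part A k with k of value 0.                                                *)
Definition part n (A : setpart n) (k : 'I_#|A|) : {set 'I_n} :=
  nth set0 (sort (fun X Y => part_min X <= part_min Y)%N (enum A)) k.

Definition subparts n (A : setpart n) (K : {set 'I_#|A|}) : {set {set 'I_n}} :=
  [set part k | k in K].

(* For B a set partition of X = cover B, enum_val : 'I_#|X| -> 'I_n is the    *)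
(* increasing enumeration of X (see enum_val_incr).                           *)
Definition std_parts n (B : {set {set 'I_n}}) : {set {set 'I_#|cover B|}} :=
  [set (fun i : 'I_#|cover B| => enum_val i) @^-1: X | X : {set 'I_n} in B].

Definition bar_parts m n (B : {set {set 'I_m}}) (C : {set {set 'I_n}}) :
    {set {set 'I_(m + n)}} :=
  [set @lshift m n @: X | X : {set 'I_m} in B] :|:
  [set @rshift m n @: Y | Y : {set 'I_n} in C].

Lemma enum_val_incr n (X : {set 'I_n}) (i j : 'I_#|X|) :
  (i < j)%N -> (enum_val i < enum_val j)%N.
Proof.
move=> lt_ij; have x0 : 'I_n := enum_val i.
rewrite !(enum_val_nth x0).
have srt : sorted (fun a b : 'I_n => a < b)%N (enum X).
  rewrite /enum_mem -enumT.
  apply: sorted_filter; first by move=> y x z; apply: ltn_trans.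
  have := iota_ltn_sorted 0 n; rewrite -val_enum_ord sorted_map.
  by rewrite enumT.
have tr : transitive (fun a b : 'I_n => a < b)%N.
  by move=> y x z; apply: ltn_trans.
by apply: (sorted_ltn_nth tr x0 srt) => //; rewrite inE -cardE ltn_ord.
Qed.

Lemma part_in n (A : setpart n) (k : 'I_#|A|) : part k \in (A : {set _}).
Proof.
rewrite -mem_enum -(mem_sort (fun X Y => part_min X <= part_min Y)%N).
by apply: mem_nth; rewrite size_sort -cardE ltn_ord.
Qed.

Lemma part_inj n (A : setpart n) : injective (@part n A).
Proof.
move=> k l /eqP; rewrite nth_uniq ?size_sort -?cardE ?ltn_ord //.
  by move/eqP/val_inj.
by rewrite sort_uniq enum_uniq.
Qed.

Lemma subparts_partition n (A : setpart n) (K : {set 'I_#|A|}) :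
  partition (subparts K) (cover (subparts K)).
Proof.
have sub : subparts K \subset A by apply/subsetP=> _ /imsetP[k _ ->]; apply: part_in.
have /and3P[_ tA A0] := partsP A.
rewrite /partition eqxx /= (trivIsetS sub tA) /=.
by apply: contra A0; apply: (subsetP sub).
Qed.

Lemma std_parts_partition n (B : {set {set 'I_n}}) :
  partition B (cover B) -> partition (std_parts B) [set: 'I_#|cover B|].
Proof.
move=> pB; pose f (i : 'I_#|cover B|) : 'I_n := enum_val i.
have f_inj : injective f by apply: enum_val_inj.
rewrite -(imset_partition _ _ f_inj).
have fT : f @: [set: 'I_#|cover B|] = cover B.
  apply/setP=> x; apply/imsetP/idP => [[i _ ->]|xB]; first exact: enum_valP.
  by exists (enum_rank_in xB x); rewrite // /f enum_rankK_in.
rewrite fT.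
suff -> : [set f @: X | X : {set _} in std_parts B] = B by [].
rewrite -imset_comp -[RHS]imset_id; apply: eq_in_imset => X XB /=.
apply/setP=> x; apply/imsetP/idP => [[i + ->]|xX]; first by rewrite inE.
have xc : x \in cover B by apply/bigcupP; exists X.
by exists (enum_rank_in xc x); rewrite ?inE /f enum_rankK_in.
Qed.

Lemma bar_parts_partition m n (B : setpart m) (C : setpart n) :
  partition (bar_parts B C) [set: 'I_(m + n)].
Proof.
have := partsP B; rewrite -(imset_partition _ _ (@lshift_inj m n)).
have := partsP C; rewrite -(imset_partition _ _ (@rshift_inj m n)).
rewrite /bar_parts; set P := [set _ | _ in C]; set Q := [set _ | _ in B].
move=> pP pQ; have [/and3P[/eqP cP tP P0] /and3P[/eqP cQ tQ Q0]] := (pP, pQ).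
rewrite /partition inE negb_or P0 Q0 !andbT.
apply/andP; split; last first.
  apply: trivIsetU => //; rewrite cP cQ.
  rewrite disjoints_subset; apply/subsetP=> _ /imsetP[i _ ->].
  by rewrite inE; apply/imsetP=> -[j _ /eqP]; rewrite eq_lrshift.
rewrite {1}/cover bigcup_setU -!/(cover _) cP cQ; apply/eqP/setP=> i.
rewrite !inE; case: (split_ordP i) => j ->.
  by rewrite imset_f ?inE.
by rewrite orbC imset_f ?inE.
Qed.

Definition std_sub n (A : setpart n) (K : {set 'I_#|A|}) : spart :=
  to_spart (SetPart (std_parts_partition (subparts_partition K))).

Definition bar (B C : spart) : spart :=
  to_spart (SetPart (bar_parts_partition (tagged B) (tagged C))).

Lemma spart0_subproof : partition set0 [set: 'I_0].
Proof.
have -> : [set: 'I_0] = set0 by apply/setP=> -[].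
by rewrite partition_set0.
Qed.

Definition spart0 : spart := to_spart (SetPart spart0_subproof).

Lemma spart_eq n n' (A : setpart n) (B : setpart n') (e : n = n') :
  [set cast_ord e @: X | X : {set 'I_n} in A] = B -> to_spart A = to_spart B.
Proof.
subst n'; move=> eAB; congr (to_spart _); apply: val_inj => /=; rewrite -eAB.
rewrite -[LHS]imset_id; apply: eq_imset => X.
rewrite -[LHS]imset_id; apply: eq_imset => i.
by rewrite cast_ord_id.
Qed.

Lemma spart_tag0 (A : spart) : tag A = 0%N -> A = spart0.
Proof.
case: A => n A /= n0; subst n; congr existT; apply: val_inj => /=.
have := partsP A; have -> : [set: 'I_0] = set0 by apply/setP=> -[].
by rewrite partition_set0 => /eqP.
Qed.

Lemma barA : associative bar.
Proof.
move=> [m A] [n B] [p C]; rewrite /bar /=; apply: (spart_eq (e := addnA m n p)).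
rewrite /= /bar_parts !imsetU -!imset_comp -setUA; congr (_ :|: (_ :|: _)).
all: apply: eq_imset => X /=; rewrite -!imset_comp; apply: eq_imset => i.
all: by apply: val_inj; rewrite /= ?addnA.
Qed.

Lemma bar0s : left_id spart0 bar.
Proof.
move=> [n A]; rewrite /bar /=; apply: (spart_eq (e := add0n n)).
rewrite /= /bar_parts imset0 set0U -imset_comp -[RHS]imset_id.
apply: eq_imset => X /=; rewrite -imset_comp -[RHS]imset_id.
by apply: eq_imset => i; apply: val_inj.
Qed.

Lemma bars0 : right_id spart0 bar.
Proof.
move=> [n A]; rewrite /bar /=; apply: (spart_eq (e := addn0 n)).
rewrite /= /bar_parts imset0 setU0 -imset_comp -[RHS]imset_id.
apply: eq_imset => X /=; rewrite -imset_comp -[RHS]imset_id.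
by apply: eq_imset => i; apply: val_inj.
Qed.

Lemma bar_unit (B C : spart) : bar B C = spart0 -> B = spart0 /\ C = spart0.
Proof.
move=> /(congr1 tag) /= /eqP; rewrite addn_eq0 => /andP[/eqP b0 /eqP c0].
by split; apply: spart_tag0.
Qed.

HB.instance Definition _ :=
  Choice_isMonomialDef.Build spart barA bar0s bars0 bar_unit.

(* The monoid algebra of (spart, bar): the rational vector space with basis   *)
(* spart, with the bilinear extension of bar as product and 1 = << spart0 >>. *)
Notation NCSym := {malg rat[spart]}.

(* The tensor square of NCSym, (B, C) standing for the basis element          *)
(* B (x) C.                                                                   *)
Notation NCSym2 := {malg rat[(spart * spart)%type]}.

Definition tensor (x y : NCSym) : NCSym2 :=
  \sum_(B <- msupp x) \sum_(C <- msupp y) (x@_B * y@_C) *: << (B, C) >>.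

Definition coprod_basis (A : spart) : NCSym2 :=
  \sum_(KL : {set 'I_#|tagged A|} * {set 'I_#|tagged A|}
        | (KL.1 :|: KL.2 == setT) && (KL.1 :&: KL.2 == set0))
     << (std_sub KL.1, std_sub KL.2) >>.

Definition coprod (x : NCSym) : NCSym2 :=
  \sum_(A <- msupp x) x@_A *: coprod_basis A.

Definition primitive (x : NCSym) : Prop :=
  coprod x = tensor x 1 + tensor 1 x.

Definition atomic n (A : setpart n) : bool :=
  (0 < n)%N &&
  ~~ [exists B : {set {set 'I_n}}, exists m : 'I_n,
        [&& B \subset A, (0 < m)%N & partition B [set i : 'I_n | (i < m)%N]]].

Definition set_composition r (K : {set 'I_r}) (g : seq {set 'I_r}) : bool :=
  [&& set0 \notin g,
      pairwise (fun X Y : {set 'I_r} => [disjoint X & Y]) g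
    & \bigcup_(X <- g) X == K].

Lemma set_composition_size r (K : {set 'I_r}) (g : seq {set 'I_r}) :
  set_composition K g -> (size g <= r)%N.
Proof.
case/and3P=> g0 dg /eqP _.
suff: (size g <= #|\bigcup_(X <- g) X|)%N.
  by move/leq_trans; apply; rewrite -[leqRHS]card_ord max_card.
elim: g g0 dg => [|X g IHg] //=; rewrite in_cons negb_or big_cons.
case/andP=> X0 g0 /andP[dX dg]; rewrite cardsU.
have -> : X :&: \bigcup_(Y <- g) Y = set0.
  rewrite big_distrr /= big_seq big1 // => Y Yg; apply/eqP.
  by rewrite setI_eq0 (allP dX).
rewrite cards0 subn0 -add1n leq_add ?IHg // card_gt0 eq_sym //.
Qed.

(* The set compositions of [r] whose first block contains 1, that is the      *)
(* ordinal of value 0; there are none for r = 0.                              *)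
Definition first_composition r (g : seq {set 'I_r}) : bool :=
  set_composition [set: 'I_r] g &&
  [exists i : 'I_r, (i == 0 :> nat) && (i \in head set0 g)].

Definition comp_act n (A : setpart n) (g : seq {set 'I_#|A|}) : spart :=
  \big[bar/spart0]_(K <- g) std_sub K.

(* Sequences of length at most r suffice by set_composition_size.             *)
Definition pelt n (A : setpart n) : NCSym :=
  \sum_(g : #|A|.-bseq {set 'I_#|A|} | first_composition g)
     (-1) ^+ (size g).-1 *: << comp_act g >>.

(* Main.v *)
From HB Require Import structures.
Require Import Defs.
From mathcomp Require Import all_boot all_order all_algebra.
From mathcomp Require Import finmap monalg.

Set Implicit Arguments.
Unset Strict Implicit.
Unset Printing Implicit Defensive.

Import GRing.Theory.
Local Open Scope ring_scope.

(** The functions f of a subset K of the set of indices of the parts of A, with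
values in a ring, form a ring for the product
  (f g)(K) = sum over the subsets L of K of f(L) g(K \ L).
Let X(K) = A_K standardized, an element of NCSym. Since X(empty) = 1 and
functions that vanish at the empty set are nilpotent, X is invertible with
inverse the sum of the powers of 1 - X, and the value at K of this inverse is
the sum of (-1)^l(g) g[A] over the set compositions g of K. Let D cut a function
down to the sets that contain the first index. As this index lies in exactly one
of L and K \ L, D is a derivation, and p(A) is the value at the full set of the
logarithmic derivative (D X) X^-1 (lemma pelt_logder).

Primitivity. The coproduct Delta is a ring morphism, and the definition of
Delta A says that Delta X = X1 X2, where X1 = X (x) 1 and X2 = 1 (x) X commute.
The logarithmic derivative turns products of commuting functions into sums, so
Delta((D X) X^-1) = (D X1) X1^-1 + (D X2) X2^-1, which is primitivity
(logder_primitive).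

Vanishing. If A = B|C, let U be the set of the indices of the parts that come
from B. Then X is the product of its restrictions to the subsets of U and to the
subsets of the complement of U (std_fun_factor). The first index is in U, so D
kills the second factor and the logarithmic derivative of X is that of the first
factor, a function supported on the subsets of U (logder_support); the full set
is not one of them.

Nonvanishing. The composition with one block contributes A itself, and a
composition with several blocks contributes a product, which is not atomic. So
the coefficient of an atomic A in p(A) is 1 (pelt_coeff).

The combinatorial input is that the standardization of a set of parts is
determined by the existence of an increasing map that carries it to these parts
(standardizes_uniq). All identities between standardizations, among them the
multiplicativity of Delta, follow by composing or gluing increasing maps. *)

(** * The convolution ring of set functions *)

(** A name of its own keeps the pointwise product of functions away from the
convolution product put on it below. *)
Definition setfun (T : finType) (R : nzRingType) : Type := {ffun {set T} -> R}.

HB.instance Definition _ (T : finType) (R : nzRingType) :=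
  GRing.Zmodule.copy (setfun T R) {ffun {set T} -> R}.

Section SetfunRing.

Variables (T : finType) (R : nzRingType).
Implicit Types (f g h : setfun T R) (K L M : {set T}).

Definition setfun_one : setfun T R := [ffun K : {set T} => (K == set0)%:R].

Definition setfun_mul f g : setfun T R :=
  [ffun K : {set T} => \sum_(L : {set T} | L \subset K) f L * g (K :\: L)].

Lemma setfun_mulA : associative setfun_mul.
Proof.
move=> f g h; apply/ffunP=> K; rewrite !ffunE.
under eq_bigr do rewrite ffunE mulr_sumr.
under [RHS]eq_bigr do rewrite ffunE mulr_suml.
rewrite [RHS](exchange_big_dep (fun L : {set T} => L \subset K)) /=; last first.
  by move=> N L NK LN; apply: subset_trans NK.
apply: eq_bigr => L LK.
rewrite [RHS](reindex_onto (fun M => L :|: M) (fun N => N :\: L)) /=; last first.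
  by move=> N /andP[_ LN]; rewrite -[RHS](setID N L) (setIidPr LN).
apply: eq_big => [M|M MK].
  rewrite subUset LK subsetUl andbT setDUl setDv set0U subsetD.
  by congr (_ && _); apply/setDidPl/eqP.
move: MK; rewrite subsetD => /andP[MK ML].
by rewrite mulrA setDUl setDv set0U setDDl (setDidPl ML).
Qed.

Lemma setfun_mul1f : left_id setfun_one setfun_mul.
Proof.
move=> f; apply/ffunP=> K; rewrite !ffunE (bigD1 set0) ?sub0set //=.
rewrite !ffunE eqxx mul1r setD0 big1 ?addr0 // => L /andP[_ /negPf L0].
by rewrite ffunE L0 mul0r.
Qed.

Lemma setfun_mulf1 : right_id setfun_one setfun_mul.
Proof.
move=> f; apply/ffunP=> K; rewrite !ffunE (bigD1 K) //=.
rewrite !ffunE setDv eqxx mulr1 big1 ?addr0 // => L /andP[LK nLK].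
rewrite ffunE setD_eq0; case: (boolP (K \subset L)) => KL; last by rewrite mulr0.
by case/eqP: nLK; apply/eqP; rewrite eqEsubset LK.
Qed.

Lemma setfun_mulDl : left_distributive setfun_mul +%R.
Proof.
move=> f g h; apply/ffunP=> K; rewrite !ffunE -big_split /=.
by apply: eq_bigr => L _; rewrite ffunE mulrDl.
Qed.

Lemma setfun_mulDr : right_distributive setfun_mul +%R.
Proof.
move=> f g h; apply/ffunP=> K; rewrite !ffunE -big_split /=.
by apply: eq_bigr => L _; rewrite ffunE mulrDr.
Qed.

HB.instance Definition _ := GRing.Zmodule_isPzRing.Build (setfun T R)
  setfun_mulA setfun_mul1f setfun_mulf1 setfun_mulDl setfun_mulDr.

Lemma setfun1E K : (1 : setfun T R) K = (K == set0)%:R.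
Proof. by rewrite ffunE. Qed.

Lemma setfunME f g K :
  (f * g) K = \sum_(L : {set T} | L \subset K) f L * g (K :\: L).
Proof. by rewrite ffunE. Qed.

(** The substitution of K \ L for L exchanges the two factors. *)
Lemma setfun_comm f g : (forall K L, GRing.comm (f K) (g L)) -> GRing.comm f g.
Proof.
move=> fg; apply/ffunP=> K; rewrite !setfunME.
rewrite (reindex_onto (fun L => K :\: L) (fun L => K :\: L)) /=; last first.
  by move=> L LK; rewrite setDDr setDv set0U; apply/setIidPr.
apply: eq_big => [L|L /andP[_ /eqP->]]; last exact: fg.
by rewrite subsetDl setDDr setDv set0U /=; apply/eqP/idP => /setIidPr.
Qed.

Definition der (i : T) f : setfun T R :=
  [ffun K : {set T} => if i \in K then f K else 0].

(** When i is in K, it lies in exactly one of L and K \ L, so exactly one of the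
two products on the right keeps the term of L. *)
Lemma derM i f g : der i (f * g) = der i f * g + f * der i g.
Proof.
apply/ffunP=> K; rewrite !ffunE -big_split /=; case: ifPn => iK.
  apply: eq_bigr => L LK; rewrite !ffunE inE iK andbT.
  by case: ifP; rewrite ?mul0r ?mulr0 ?addr0 ?add0r.
rewrite big1 // => L LK; rewrite !ffunE inE (negPf iK) andbF.
by rewrite (contraNF (subsetP LK i) iK) mul0r mulr0 addr0.
Qed.

Definition res (U : {set T}) f : setfun T R :=
  [ffun K : {set T} => if K \subset U then f K else 0].

(** K is contained in U exactly when both L and K \ L are. *)
Lemma resM U f g : res U (f * g) = res U f * res U g.
Proof.
apply/ffunP=> K; rewrite !ffunE; case: ifPn => KU.
  apply: eq_bigr => L LK; rewrite !ffunE (subset_trans LK KU).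
  by rewrite (subset_trans (subsetDl K L) KU).
rewrite big1 // => L LK; rewrite !ffunE.
case: ifP => LU; last by rewrite mul0r.
case: ifP => DU; last by rewrite mulr0.
by case/negP: KU; rewrite -(setID K L) subUset DU (setIidPr LK) LU.
Qed.

Lemma der_res i U f : der i (res U f) = res U (der i f).
Proof. by apply/ffunP=> K; rewrite !ffunE; do 2 case: ifP. Qed.

(** The functions of order at least m, in the filtration by cardinality that
makes 1 - f nilpotent when f is 1 at the empty set. *)
Definition vanish m f := forall K, (#|K| < m)%N -> f K = 0.

Lemma vanishM m n f g : vanish m f -> vanish n g -> vanish (m + n) (f * g).
Proof.
move=> fm gn K Kmn; rewrite setfunME big1 // => L LK.
have [/fm ->|mL] := ltnP #|L| m; first by rewrite mul0r.
rewrite gn ?mulr0 // cardsD (setIidPr LK).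
by rewrite ltn_subLR ?subset_leq_card // (leq_trans Kmn) ?leq_add2r.
Qed.

Lemma vanishX n f : f set0 = 0 -> vanish n (f ^+ n).
Proof.
move=> f0; elim: n => [|n IHn]; first by [].
rewrite exprS -add1n; apply: vanishM => // K.
by rewrite ltnS leqn0 cards_eq0 => /eqP->.
Qed.

Lemma vanish_card f : vanish #|T|.+1 f -> f = 0.
Proof. by move=> f0; apply/ffunP=> K; rewrite f0 ?ffunE // ltnS max_card. Qed.

(** The geometric series of 1 - f; the terms beyond the cardinality of T are
zero. *)
Definition setfun_inv f : setfun T R := \sum_(s < #|T|.+1) (1 - f) ^+ s.

Lemma setfun_mulV f : f set0 = 1 -> f * setfun_inv f = 1.
Proof.
move=> f0; have /vanish_card nil : vanish #|T|.+1 ((1 - f) ^+ #|T|.+1).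
  by apply: vanishX; rewrite !ffunE eqxx f0 subrr.
apply: oppr_inj; rewrite -mulNr; have := subrX1 (1 - f) #|T|.+1.
by rewrite nil sub0r addrAC subrr sub0r => ->.
Qed.

Lemma setfun_mulVf f : f set0 = 1 -> setfun_inv f * f = 1.
Proof.
move=> f0; rewrite -[RHS](setfun_mulV f0); apply/commr_sym.
apply: commr_sum => s _; apply: commrX; apply: commrB => //.
exact: commr1.
Qed.

End SetfunRing.

Definition smap (T : finType) (R S : nzRingType) (phi : R -> S)
    (f : setfun T R) : setfun T S := [ffun K : {set T} => phi (f K)].

Lemma smapM (T : finType) (R S : nzRingType) (phi : {rmorphism R -> S})
    (f g : setfun T R) : smap phi (f * g) = smap phi f * smap phi g.
Proof.
apply/ffunP=> K; rewrite !ffunE rmorph_sum /=.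
by apply: eq_bigr => L _; rewrite !ffunE rmorphM.
Qed.

Lemma smap_der (T : finType) (R S : nzRingType) (phi : {rmorphism R -> S}) i
    (f : setfun T R) : smap phi (der i f) = der i (smap phi f).
Proof. by apply/ffunP=> K; rewrite !ffunE; case: ifP; rewrite ?rmorph0. Qed.

(** * Logarithmic derivatives *)

Section LogDerivative.

Variables (T : finType) (R : nzRingType) (i : T).
Implicit Types (f g p : setfun T R) (U : {set T}).

Definition logder f := der i f * setfun_inv f.

Lemma logder_mul f : f set0 = 1 -> logder f * f = der i f.
Proof. by move=> f0; rewrite -mulrA setfun_mulVf // mulr1. Qed.

Lemma logder_uniq f p : f set0 = 1 -> p * f = der i f -> p = logder f.
Proof. by move=> f0 pf; rewrite /logder -pf -mulrA setfun_mulV // mulr1. Qed.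

Lemma setfunM0 f g : f set0 = 1 -> g set0 = 1 -> (f * g) set0 = 1.
Proof.
move=> f0 g0; rewrite setfunME (big_pred1 set0) => [|L]; last exact: subset0.
by rewrite setD0 f0 g0 mulr1.
Qed.

(** (D(fg)) (fg)^-1 = (D f) f^-1 + f ((D g) g^-1) f^-1, and f commutes with the
middle factor of the last term. *)
Lemma logderM f g : f set0 = 1 -> g set0 = 1 -> GRing.comm f (logder g) ->
  logder (f * g) = logder f + logder g.
Proof.
move=> f0 g0 fg; apply/esym/logder_uniq; first exact: setfunM0.
by rewrite derM mulrDl !mulrA logder_mul // -[logder g * f]fg -mulrA logder_mul.
Qed.

Lemma logder_res U f : f set0 = 1 -> res U (logder f) = logder (res U f).
Proof.
move=> f0; apply: logder_uniq; first by rewrite ffunE sub0set.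
by rewrite -resM logder_mul // der_res.
Qed.

(** D kills the second factor, so only the logarithmic derivative of the first
remains, and that is computed within the subsets of U. *)
Lemma logder_support U f : f set0 = 1 -> i \in U ->
  f = res U f * res (~: U) f -> res U (logder f) = logder f.
Proof.
move=> f0 iU fE; have res0 (V : {set T}) : res V f set0 = 1 by rewrite ffunE sub0set.
have dC : logder (res (~: U) f) = 0.
  rewrite /logder [der _ _](_ : _ = 0) ?mul0r //.
  apply/ffunP=> K; rewrite !ffunE; case: ifP => // iK.
  by case: ifP => // /subsetP/(_ i iK); rewrite in_setC iU.
rewrite logder_res // [in RHS]fE logderM ?dC ?addr0 //; exact: commr0.
Qed.

End LogDerivative.

Lemma logder_smap (T : finType) (R S : nzRingType) (phi : {rmorphism R -> S}) i
    (f : setfun T R) :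
  f set0 = 1 -> smap phi (logder i f) = logder i (smap phi f).
Proof.
move=> f0; apply: logder_uniq; first by rewrite ffunE f0 rmorph1.
by rewrite -smapM logder_mul // smap_der.
Qed.

Lemma smap_comm (T : finType) (R S : nzRingType) (phi psi : R -> S)
    (f g : setfun T R) : (forall x y, GRing.comm (phi x) (psi y)) ->
  GRing.comm (smap phi f) (smap psi g).
Proof. by move=> phipsi; apply: setfun_comm => K L; rewrite !ffunE. Qed.

(** If Delta maps f to a product of two commuting copies of f, then the logarithmic
derivative turns this product into the sum of the two copies. *)
Lemma logder_primitive (T : finType) (R S : nzRingType)
    (Delta l r : {rmorphism R -> S}) i (f : setfun T R) (K : {set T}) :
  f set0 = 1 -> (forall x y, GRing.comm (l x) (r y)) ->
  smap Delta f = smap l f * smap r f ->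
  Delta (logder i f K) = l (logder i f K) + r (logder i f K).
Proof.
move=> f0 lr Df; have phi0 (phi : {rmorphism R -> S}) : smap phi f set0 = 1.
  by rewrite ffunE f0 rmorph1.
have := logder_smap Delta i f0.
rewrite Df logderM ?phi0 // -!logder_smap //; last exact: smap_comm.
by move/ffunP/(_ K); rewrite !ffunE.
Qed.

(** * Inverses and set compositions *)

Lemma set_composition_nil r (K : {set 'I_r}) :
  set_composition K [::] = (K == set0).
Proof. by rewrite /set_composition big_nil /= eq_sym. Qed.

Lemma set_composition_cons r (K L : {set 'I_r}) g :
  set_composition K (L :: g) =
  [&& L != set0, L \subset K & set_composition (K :\: L) g].
Proof.
rewrite /set_composition inE negb_or pairwise_cons big_cons eq_sym -!andbA.
case: (L != set0) => //=; case: (set0 \notin g); rewrite /= ?andbF //.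
case: (pairwise _ g); rewrite /= ?andbF //.
have -> : all (fun Y : {set 'I_r} => [disjoint L & Y]) g =
          [disjoint L & \bigcup_(X <- g) X].
  elim: g => [|X g IHg] /=; first by rewrite big_nil -setI_eq0 setI0 eqxx.
  by rewrite big_cons IHg -!setI_eq0 setIUr setU_eq0.
apply/andP/andP => [[dL /eqP <-]|[LK /eqP ->]].
  by rewrite subsetUl setDUl setDv set0U eq_sym (setDidPl _) // disjoint_sym.
split; first by rewrite disjoint_sym disjoints_subset subsetDr.
by rewrite -[X in _ == X](setID K L) (setIidPr LK).
Qed.

Lemma big_bseq (R : nmodType) (T : finType) n (P : pred (seq T))
    (F : seq T -> R) :
  \sum_(g : n.-bseq T | P g) F g =
  \sum_(s < n.+1) \sum_(t : s.-tuple T | P t) F t.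
Proof.
rewrite sig_big_dep (reindex bseq_tagged_tuple) /=; first by [].
by apply: onW_bij.
Qed.

Lemma big_tuple_cons (R : nmodType) (T : finType) n (P : pred (seq T))
    (F : seq T -> R) :
  \sum_(t : n.+1.-tuple T | P t) F t =
  \sum_(x : T) \sum_(t : n.-tuple T | P (x :: t)) F (x :: t).
Proof.
rewrite pair_big_dep (reindex (fun p : T * n.-tuple T => [tuple of p.1 :: p.2])) //=.
exists (fun t => (thead t, [tuple of behead t])) => [[x t] _|t _] /=.
  by congr (_, _); apply: val_inj.
by rewrite -tuple_eta.
Qed.

Section Compositions.

Variables (r : nat) (R : nzRingType) (f : setfun 'I_r R).
Hypothesis f0 : f set0 = 1.

Let w (g : seq {set 'I_r}) := \prod_(L <- g) f L.

(** Splitting off the first block; the factor h singles it out, which is how the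
condition on the first block of a composition enters. *)
Lemma mul_compositions (h : setfun 'I_r R) s K : h set0 = 0 ->
  (forall L, ((1 - f) ^+ s) L =
     \sum_(t : s.-tuple {set 'I_r} | set_composition L t) (-1) ^+ s * w t) ->
  (h * (1 - f) ^+ s) K =
  \sum_(t : s.+1.-tuple {set 'I_r} | set_composition K t)
     (-1) ^+ s * (h (head set0 t) * w (behead t)).
Proof.
move=> h0 fs.
rewrite (@big_tuple_cons _ _ s (set_composition K)
  (fun t => (-1) ^+ s * (h (head set0 t) * w (behead t)))).
rewrite setfunME big_mkcond; apply: eq_bigr => L _.
under eq_bigl do rewrite set_composition_cons.
have [->|L0 /=] := eqVneq L set0.
  by rewrite big_pred0 // h0 mul0r if_same.
case: ifP => LK /=; last by rewrite big_pred0.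
rewrite fs mulr_sumr; apply: eq_bigr => t _ /=.
by rewrite mulrA (commr_sign (h L) s) -mulrA.
Qed.

(** 1 - f is - f on the nonempty sets and 0 at the empty set, so that the s-th
power sums over the ways to write K as a sequence of s nonempty blocks. *)
Lemma pow_compositions s K : ((1 - f) ^+ s) K =
  \sum_(t : s.-tuple {set 'I_r} | set_composition K t) (-1) ^+ s * w t.
Proof.
elim: s K => [|s IHs] K.
  rewrite expr0 setfun1E; case: eqVneq => K0.
    rewrite (big_pred1 [tuple]) ?expr0 ?mul1r /w ?big_nil // => t.
    by rewrite (tuple0 t) set_composition_nil K0 !eqxx.
  rewrite big_pred0 // => t.
  by rewrite (tuple0 t) set_composition_nil; apply/negbTE.
rewrite exprS mul_compositions //; last by rewrite !ffunE eqxx f0 subrr.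
apply: eq_bigr => t; case/tupleP: t => L t; rewrite set_composition_cons.
case/andP=> L0 _; rewrite /w big_cons /= !ffunE (negPf L0) sub0r.
by rewrite exprSr mulrN1 mulNr -mulrN mulNr.
Qed.

(** The truncation der i forces i into the first block and each factor 1 - f of
the inverse adds one block with a sign. The last term of the inverse does not
contribute: it would ask for more blocks than there are indices. *)
Lemma der_inv_compositions (i : 'I_r) :
  (der i f * setfun_inv f) setT =
  \sum_(g : r.-bseq {set 'I_r} | set_composition setT g && (i \in head set0 g))
     (-1) ^+ (size g).-1 * w g.
Proof.
pose P (g : seq {set 'I_r}) := set_composition setT g && (i \in head set0 g).
rewrite (@big_bseq R _ r P (fun g => (-1) ^+ (size g).-1 * w g)).
rewrite big_ord_recl /= big_pred0 ?add0r; last first.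
  by move=> t; rewrite /P (tuple0 t) /= inE andbF.
rewrite /setfun_inv big_ord_recr /= mulrDr mulr_sumr.
have der0 : der i f set0 = 0 by rewrite ffunE inE.
have -> : der i f * (1 - f) ^+ #|'I_r| = 0.
  apply: vanish_card; rewrite -add1n; apply: vanishM.
    by move=> K; rewrite ltnS leqn0 cards_eq0 => /eqP ->.
  by apply: vanishX; rewrite !ffunE eqxx f0 subrr.
rewrite addr0 sum_ffunE card_ord; apply: eq_bigr => s _.
rewrite mul_compositions //; last exact: pow_compositions.
rewrite [RHS]big_mkcondr; apply: eq_bigr => t _; case/tupleP: t => L t.
rewrite /= size_tuple ffunE /w big_cons.
by case: ifP; rewrite // mul0r mulr0.
Qed.

End Compositions.

(** * Standardization *)

Lemma sub_partition (T : finType) (P Q : {set {set T}}) (D : {set T}) :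
  partition P D -> Q \subset P -> partition Q (cover Q).
Proof.
move=> /and3P[_ tP P0] QP; rewrite /partition eqxx (trivIsetS QP tP) /=.
by apply: contra P0; apply: (subsetP QP).
Qed.

Lemma cover_imset_imset (T T' : finType) (f : T -> T') (P : {set {set T}}) :
  cover [set f @: X | X : {set T} in P] = f @: cover P.
Proof. by rewrite cover_imset imset_cover. Qed.

Lemma imset_setD (T T' : finType) (f : T -> T') (A B : {set T}) :
  injective f -> f @: (A :\: B) = f @: A :\: f @: B.
Proof.
move=> fI; apply/setP=> y; rewrite in_setD; apply/imsetP/andP => [[x + ->]|].
  by rewrite inE => /andP[xB xA]; rewrite !(mem_imset _ _ fI).
case=> yB /imsetP[x xA yx]; exists x => //; rewrite inE xA andbT.
by apply: contra yB => xB; rewrite yx imset_f.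
Qed.

Definition increasing m n (f : 'I_m -> 'I_n) :=
  forall i j : 'I_m, (i < j)%N -> (f i < f j)%N.

Lemma increasing_inj m n (f : 'I_m -> 'I_n) : increasing f -> injective f.
Proof.
move=> f_inc i j fij; apply/val_inj; apply/eqP.
by case: ltngtP => // /f_inc; rewrite fij ltnn.
Qed.

(** The values of an increasing map are the elements of its image in increasing
order. *)
Lemma increasing_eq m n (f g : 'I_m -> 'I_n) : increasing f -> increasing g ->
  f @: setT = g @: setT -> f =1 g.
Proof.
pose lt k (i j : 'I_k) := (i < j)%N.
have lt_tr k : transitive (@lt k) by move=> y x z; apply: ltn_trans.
have srt : sorted (@lt m) (enum 'I_m).
  by have := iota_ltn_sorted 0 m; rewrite -val_enum_ord sorted_map.
move=> f_inc g_inc fg.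
suff /eq_in_map fgE : map f (enum 'I_m) = map g (enum 'I_m).
  by move=> i; apply: fgE; rewrite mem_enum.
apply: (irr_sorted_eq (@lt_tr n)).
- by move=> i; apply: ltnn.
- by apply: (homo_sorted f_inc).
- by apply: (homo_sorted g_inc).
move=> y; have := congr1 (fun D : {set _} => y \in D) fg => /=.
have im (h : 'I_m -> 'I_n) : (y \in h @: setT) = (y \in map h (enum 'I_m)).
  by apply/imsetP/mapP => -[i _ ->]; exists i; rewrite ?mem_enum.
by rewrite !im.
Qed.

(** Standardization as a relation: it is invariant under increasing maps by
definition, whereas the standardization computed by enumeration lives on an
ordinal type that depends on the cardinality of the cover. *)
Definition standardizes (A : spart) n (B : {set {set 'I_n}}) : Prop :=
  exists2 f : 'I_(tag A) -> 'I_n, increasing f &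
    [set f @: X | X : {set 'I_(tag A)} in tagged A] = B.

(** Both maps are increasing with the union of B as image, hence they are
equal. *)
Lemma standardizes_uniq (A A' : spart) n (B : {set {set 'I_n}}) :
  standardizes A B -> standardizes A' B -> A = A'.
Proof.
case: A A' => a A [a' A'] [f /= f_inc fA] [g /= g_inc gA'].
have [fI gI] := (increasing_inj f_inc, increasing_inj g_inc).
have fg : f @: setT = g @: setT.
  rewrite -(cover_partition (partsP A)) -(cover_partition (partsP A')).
  by rewrite -!cover_imset_imset fA gA'.
have aa' : a = a'.
  have := congr1 (fun D : {set _} => #|D|) fg.
  by rewrite !card_imset // !cardsT !card_ord.
subst a'; congr existT; apply: val_inj => /=.
apply: (imset_inj (imset_inj fI)); rewrite fA -gA'.
apply: eq_imset => X; apply: eq_imset => i.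
by rewrite (increasing_eq f_inc g_inc fg).
Qed.

Lemma standardizes_refl (A : spart) : standardizes A (tagged A).
Proof.
exists id => //; rewrite -[RHS]imset_id.
by apply: eq_imset => X; rewrite imset_id.
Qed.

Lemma standardizes_imset (A : spart) n m (B : {set {set 'I_n}})
    (g : 'I_n -> 'I_m) : increasing g -> standardizes A B ->
  standardizes A [set g @: X | X : {set 'I_n} in B].
Proof.
move=> g_inc [f f_inc <-]; exists (g \o f) => [i j /f_inc/g_inc //|].
by rewrite -imset_comp; apply: eq_imset => X /=; rewrite -imset_comp.
Qed.

(** The two increasing maps glue to an increasing map because every value of
the first precedes every value of the second. *)
Lemma standardizes_bar (A B : spart) n (P Q : {set {set 'I_n}}) :
  {in cover P & cover Q, forall i j : 'I_n, (i < j)%N} ->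
  standardizes A P -> standardizes B Q -> standardizes (bar A B) (P :|: Q).
Proof.
case: A B => a A [b B] /= PQ [f /= f_inc fA] [g /= g_inc gB].
pose h (i : 'I_(a + b)) := match split i with inl k => f k | inr k => g k end.
have hl k : h (lshift b k) = f k by rewrite /h (unsplitK (inl k)).
have hr k : h (rshift a k) = g k by rewrite /h (unsplitK (inr k)).
exists h => [i j|] /=.
  case: (split_ordP i) => k ->; case: (split_ordP j) => l ->; rewrite ?hl ?hr /=.
  - exact: f_inc.
  - move=> _; apply: PQ; rewrite -?fA -?gB cover_imset_imset imset_f //.
      by rewrite (cover_partition (partsP A)).
    by rewrite (cover_partition (partsP B)).
  - move=> /ltnW kl; have := leq_trans (leq_addr k a) kl.
    by rewrite leqNgt ltn_ord.
  by rewrite ltn_add2l; apply: g_inc.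
rewrite imsetU -fA -gB -!imset_comp; congr (_ :|: _); apply: eq_imset => X /=.
  by rewrite -imset_comp; apply: eq_imset => k; rewrite /= hl.
by rewrite -imset_comp; apply: eq_imset => k; rewrite /= hr.
Qed.

Lemma std_partsK n (B : {set {set 'I_n}}) :
  [set (fun i : 'I_#|cover B| => enum_val i) @: X
     | X : {set 'I_#|cover B|} in std_parts B] = B.
Proof.
rewrite -imset_comp -[RHS]imset_id; apply: eq_in_imset => X XB /=.
apply/setP=> x; apply/imsetP/idP => [[i + ->]|xX]; first by rewrite inE.
have xc : x \in cover B by apply/bigcupP; exists X.
by exists (enum_rank_in xc x); rewrite ?inE enum_rankK_in.
Qed.

(** Total in B, so that it can be summed over sets of parts; the default value
spart0 is only reached when B is not a partition of its union. *)
Definition std n (B : {set {set 'I_n}}) : spart :=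
  if insub (std_parts B) is Some P then to_spart P else spart0.

Lemma std_sub_standardizes n (A : setpart n) (K : {set 'I_#|A|}) :
  standardizes (std_sub K) (subparts K).
Proof. by exists enum_val; [apply: enum_val_incr | apply: std_partsK]. Qed.

Lemma std_standardizes n (B : {set {set 'I_n}}) :
  partition B (cover B) -> standardizes (std B) B.
Proof.
move=> pB; rewrite /std insubT; first exact: std_parts_partition.
by move=> pS; exists enum_val; [apply: enum_val_incr | apply: std_partsK].
Qed.

Lemma stdE (A : spart) n (B : {set {set 'I_n}}) :
  partition B (cover B) -> standardizes A B -> std B = A.
Proof. by move=> /std_standardizes; apply: standardizes_uniq. Qed.

Lemma part_surj n (A : setpart n) (X : {set 'I_n}) :
  X \in (A : {set _}) -> exists k, X = @part n A k.
Proof.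
move=> XA; pose le_min (Y Z : {set 'I_n}) := (part_min Y <= part_min Z)%N.
have XS : X \in sort le_min (enum A) by rewrite mem_sort mem_enum.
have ltA : (index X (sort le_min (enum A)) < #|A|)%N.
  by rewrite [#|A|]cardE -(size_sort le_min) index_mem.
by exists (Ordinal ltA); rewrite /part nth_index.
Qed.

Lemma subpartsT n (A : setpart n) : subparts [set: 'I_#|A|] = A.
Proof.
apply/setP=> X; apply/imsetP/idP => [[k _ ->]|/part_surj[k ->]]; first exact: part_in.
by exists k.
Qed.

Lemma std_subT n (A : setpart n) : std_sub [set: 'I_#|A|] = to_spart A.
Proof.
apply: standardizes_uniq (standardizes_refl (to_spart A)).
by have := std_sub_standardizes [set: 'I_#|A|]; rewrite subpartsT.
Qed.

Lemma subpartsD n (A : setpart n) (K L : {set 'I_#|A|}) :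
  subparts (K :\: L) = subparts K :\: subparts L.
Proof. exact/imset_setD/part_inj. Qed.

(** * The tensor square and linear extensions *)

(** With this product of monoids NCSym2 is a ring, namely the tensor square of the
algebra NCSym. *)
Section MonomialPair.

Variables K1 K2 : monomType.

Definition pair_mone : K1 * K2 := (mone, mone).
Definition pair_mmul (x y : K1 * K2) : K1 * K2 := (mmul x.1 y.1, mmul x.2 y.2).

Lemma pair_mmulA : associative pair_mmul.
Proof. by move=> x y z; rewrite /pair_mmul /= !mulmA. Qed.

Lemma pair_mmul1m : left_id pair_mone pair_mmul.
Proof. by case=> a b; rewrite /pair_mmul /= !mul1m. Qed.

Lemma pair_mmulm1 : right_id pair_mone pair_mmul.
Proof. by case=> a b; rewrite /pair_mmul /= !mulm1. Qed.

Lemma pair_unitm x y : pair_mmul x y = pair_mone -> x = pair_mone /\ y = pair_mone.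
Proof.
by case: x y => [a b] [c d] [/unitm[-> ->] /unitm[-> ->]].
Qed.

HB.instance Definition _ := Choice_isMonomialDef.Build (K1 * K2)%type
  pair_mmulA pair_mmul1m pair_mmulm1 pair_unitm.

End MonomialPair.

Lemma malgUM (K : monomType) (R : nzRingType) (k l : K) :
  << k >> * << l >> = << mmul k l >> :> {malg R[K]}.
Proof. by rewrite malgM_def fgmulUU mulr1. Qed.

Lemma malgC_comm (K : monomType) (R : comNzRingType) (c : R) (x : {malg R[K]}) :
  GRing.comm c%:MP x.
Proof.
rewrite /GRing.comm [x]monalgE mulr_sumr mulr_suml; apply: eq_bigr => k _.
by rewrite !malgM_def !fgmulUU mul1m mulm1 mulrC.
Qed.

Lemma mmap_malgC (K : choiceType) (K' : monomType) (h : K -> {malg rat[K']})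
  (x : {malg rat[K]}) :
  mmap malgC h x = \sum_(A <- msupp x) x@_A *: h A.
Proof. by apply: eq_bigr => A _; rewrite mul_malgC. Qed.

(** These three maps are linear extensions of maps on the basis. For such
extensions, being a ring morphism is a property of the map on the basis. *)
Lemma coprod_mmap : coprod =1 mmap malgC coprod_basis.
Proof. by move=> x; rewrite mmap_malgC. Qed.

Lemma tensorx1_mmap :
  (tensor^~ 1) =1 mmap malgC (fun A : spart => << (A, spart0) >>).
Proof.
move=> x; rewrite mmap_malgC; apply: eq_bigr => A _.
by rewrite msuppU1 big_seq_fset1 mcoeffUU mulr1.
Qed.

Lemma tensor1x_mmap :
  (tensor 1) =1 mmap malgC (fun A : spart => << (spart0, A) >>).
Proof.
move=> x; rewrite mmap_malgC /tensor msuppU1 big_seq_fset1.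
by apply: eq_bigr => A _; rewrite mcoeffUU mul1r.
Qed.

(** * The coproduct as a ring morphism *)

Lemma big_subset_imset (V : nmodType) (T T' : finType) (f : T -> T')
    (A : {set T}) (F : {set T'} -> V) : injective f ->
  \sum_(C : {set T'} | C \subset f @: A) F C =
  \sum_(M : {set T} | M \subset A) F (f @: M).
Proof.
move=> fI; have fK (M : {set T}) : f @^-1: (f @: M) = M.
  by apply/setP=> x; rewrite inE mem_imset.
rewrite (reindex_onto (fun M : {set T} => f @: M) (fun C => f @^-1: C)) /=.
  by apply: eq_bigl => M; rewrite fK eqxx andbT sub_imset_pre fK.
move=> C /subsetP CA; apply/setP=> y; apply/imsetP/idP => [[x + ->]|yC].
  by rewrite inE.
by have /imsetP[x _ yx] := CA y yC; exists x; rewrite // inE -yx.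
Qed.

Lemma big_subsetU (V : nmodType) (T : finType) (A B : {set T})
    (F : {set T} -> V) :
  [disjoint A & B] ->
  \sum_(C : {set T} | C \subset A :|: B) F C =
  \sum_(L : {set T} | L \subset A) \sum_(M : {set T} | M \subset B) F (L :|: M).
Proof.
move=> dAB; rewrite pair_big.
rewrite (reindex_onto (fun p : {set T} * {set T} => p.1 :|: p.2)
                      (fun C => (C :&: A, C :&: B))) /=; last first.
  by move=> C CAB; rewrite -setIUr; apply/setIidPl.
apply: eq_bigl => -[L M] /=; apply/andP/andP => [[_ /eqP[<- <-]]|[LA MB]].
  by rewrite !subsetIr.
split; first exact: setUSS.
have LB : L :&: B = set0 by apply/disjoint_setI0/(disjointWl LA).
have MA : M :&: A = set0.
  by apply/disjoint_setI0; rewrite disjoint_sym; apply: disjointWr dAB.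
by rewrite !setIUl LB MA (setIidPl LA) (setIidPl MB) setU0 set0U.
Qed.

Lemma std_imset m n (B : {set {set 'I_m}}) (g : 'I_m -> 'I_n) :
  increasing g -> partition B (cover B) ->
  std [set g @: X | X : {set 'I_m} in B] = std B.
Proof.
move=> g_inc pB; have gI := increasing_inj g_inc.
apply: stdE; last by apply: standardizes_imset (std_standardizes pB).
by rewrite cover_imset_imset (imset_partition _ _ gI).
Qed.

Lemma std_subE n (A : setpart n) (K : {set 'I_#|A|}) : std (subparts K) = std_sub K.
Proof. exact: stdE (subparts_partition K) (std_sub_standardizes K). Qed.

(** The coproduct, written over the subsets of a set of parts that need not be
standardized. In this form no index of a part occurs, so that sets of parts can
be transported and united freely. *)
Definition split_sum n (B : {set {set 'I_n}}) : NCSym2 :=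
  \sum_(C : {set {set 'I_n}} | C \subset B) << (std C, std (B :\: C)) >>.

Lemma coprod_basis_subsets (A : spart) :
  coprod_basis A = split_sum (tagged A).
Proof.
case: A => n A; rewrite /coprod_basis /split_sum /=.
rewrite (reindex_onto (fun K => (K, ~: K)) fst) /=; last first.
  move=> [K L] /= /andP[/eqP KL /eqP KL0]; congr (_, _).
  apply/setP=> k; move/setP/(_ k): KL; move/setP/(_ k): KL0; rewrite !inE.
  by case: (k \in K); case: (k \in L).
rewrite -[in RHS](subpartsT A) big_subset_imset; last exact: part_inj.
apply: eq_big => [K|K _]; first by rewrite setUCr setICr !eqxx subsetT.
by rewrite -subpartsD setTD !std_subE.
Qed.

Lemma coprod_basis_standardizes (A : spart) n (B : {set {set 'I_n}}) :
  standardizes A B -> coprod_basis A = split_sum B.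
Proof.
case=> f f_inc <-; have fI := increasing_inj f_inc.
rewrite /split_sum big_subset_imset; last exact: imset_inj.
rewrite coprod_basis_subsets; apply: eq_bigr => C CA.
have pA := partsP (tagged A).
rewrite -(std_imset f_inc (sub_partition pA CA)).
rewrite -(std_imset f_inc (sub_partition pA (subsetDl _ C))).
by rewrite imset_setD //; apply: imset_inj.
Qed.

(** This is Delta X = (X (x) 1)(1 (x) X), before it is written as a product of
functions. *)
Lemma coprod_basis_std_sub n (A : setpart n) (K : {set 'I_#|A|}) :
  coprod_basis (std_sub K) =
  \sum_(L : {set 'I_#|A|} | L \subset K) << (std_sub L, std_sub (K :\: L)) >>.
Proof.
rewrite (coprod_basis_standardizes (std_sub_standardizes K)) /split_sum.
rewrite big_subset_imset; last exact: part_inj.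
by apply: eq_bigr => L _; rewrite -subpartsD !std_subE.
Qed.

Lemma std_bar n (B C : {set {set 'I_n}}) :
  {in cover B & cover C, forall i j : 'I_n, (i < j)%N} ->
  partition (B :|: C) (cover (B :|: C)) -> std (B :|: C) = bar (std B) (std C).
Proof.
move=> BC pBC; apply: stdE => //; apply: standardizes_bar => //.
  by apply/std_standardizes/(sub_partition pBC)/subsetUl.
by apply/std_standardizes/(sub_partition pBC)/subsetUr.
Qed.

Lemma coverS (T : finType) (P Q : {set {set T}}) :
  P \subset Q -> cover P \subset cover Q.
Proof.
move=> /subsetP PQ; apply/subsetP=> x /bigcupP[X XP xX].
by apply/bigcupP; exists X; rewrite ?PQ.
Qed.

(** A subset of the union of P and Q is the union of a subset of P and a subset of
Q, and standardization turns such a union into the product. *)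
Lemma split_sumU n (P Q : {set {set 'I_n}}) :
  {in cover P & cover Q, forall i j : 'I_n, (i < j)%N} ->
  partition (P :|: Q) (cover (P :|: Q)) ->
  split_sum (P :|: Q) = split_sum P * split_sum Q.
Proof.
move=> PQ pPQ; have dPQ : [disjoint P & Q].
  rewrite -setI_eq0; apply/eqP/setP=> X; rewrite !inE; apply/negP=> /andP[XP XQ].
  have /and3P[_ _ /negP P0] := pPQ; apply: P0.
  suff <- : X = set0 by rewrite inE XP.
  apply/setP=> x; rewrite inE; apply/negP=> xX.
  have : (x < x)%N by apply: PQ; apply/bigcupP; exists X.
  by rewrite ltnn.
have bar_std (C D : {set {set 'I_n}}) :
    C \subset P -> D \subset Q -> std (C :|: D) = bar (std C) (std D).
  move=> CP DQ; apply: std_bar; last by apply: sub_partition pPQ _; apply: setUSS.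
  by move=> i j /(subsetP (coverS CP)) + /(subsetP (coverS DQ)); apply: PQ.
pose F (C : {set {set 'I_n}}) : NCSym2 := << (std C, std ((P :|: Q) :\: C)) >>.
have e := big_subsetU F dPQ.
rewrite /split_sum [LHS]e.
rewrite [RHS]big_distrl; apply: eq_bigr => L LP.
rewrite [RHS]big_distrr; apply: eq_bigr => M MQ.
rewrite [RHS]malgUM; congr << _ >>; congr (_, _); first exact: bar_std.
rewrite -[RHS]bar_std ?subsetDl //; congr std; rewrite setDUl; congr (_ :|: _).
  rewrite -setDDl; apply/setDidPl/(disjointWl (subsetDl _ _)).
  exact: disjointWr dPQ.
rewrite setUC -setDDl; apply/setDidPl/(disjointWl (subsetDl _ _)).
by rewrite disjoint_sym; apply: disjointWl dPQ.
Qed.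

Lemma coprod_basis_bar (A B : spart) :
  coprod_basis (bar A B) = coprod_basis A * coprod_basis B.
Proof.
set a := tag A; set b := tag B.
have l_inc : increasing (@lshift a b) by [].
have r_inc : increasing (@rshift a b) by move=> i j; rewrite /= ltn_add2l.
rewrite (coprod_basis_standardizes (standardizes_refl (bar A B))).
rewrite (coprod_basis_standardizes (standardizes_imset l_inc (standardizes_refl A))).
rewrite (coprod_basis_standardizes (standardizes_imset r_inc (standardizes_refl B))).
apply: split_sumU.
  move=> i j; rewrite !cover_imset_imset => /imsetP[i' _ ->] /imsetP[j' _ ->] /=.
  exact: ltn_addr.
exact: sub_partition (partsP (tagged (bar A B))) _.
Qed.

Lemma std_sub0 n (A : setpart n) : std_sub (set0 : {set 'I_#|A|}) = spart0.
Proof.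
apply: spart_tag0; apply/eqP; rewrite /= cards_eq0 /subparts imset0.
by rewrite /cover big_set0.
Qed.

Lemma coprod_basis0 : coprod_basis spart0 = 1.
Proof.
have := coprod_basis_std_sub (set0 : {set 'I_#|SetPart spart0_subproof|}).
rewrite std_sub0 => ->; rewrite (big_pred1 set0) => [|L]; last exact: subset0.
by rewrite set0D std_sub0.
Qed.

HB.instance Definition _ := isMultiplicative.Build spart NCSym2 coprod_basis
  (conj coprod_basis_bar coprod_basis0).

Definition tensor_left (x : NCSym) : NCSym2 := tensor x 1.
Definition tensor_right (x : NCSym) : NCSym2 := tensor 1 x.
Definition basis_left (A : spart) : NCSym2 := << (A, spart0) >>.
Definition basis_right (A : spart) : NCSym2 := << (spart0, A) >>.

Lemma basis_left_mmorphism : mmorphism basis_left.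
Proof.
split=> // A B; rewrite [RHS]malgUM; congr << _ >>; congr (_, _).
by rewrite [RHS]bar0s.
Qed.

Lemma basis_right_mmorphism : mmorphism basis_right.
Proof.
split=> // A B; rewrite [RHS]malgUM; congr << _ >>; congr (_, _).
by rewrite [RHS]bar0s.
Qed.

HB.instance Definition _ := isMultiplicative.Build spart NCSym2 basis_left
  basis_left_mmorphism.
HB.instance Definition _ := isMultiplicative.Build spart NCSym2 basis_right
  basis_right_mmorphism.

Lemma mmap_multiplicative (h : {mmorphism spart -> NCSym2}) (F : NCSym -> NCSym2) :
  F =1 mmap malgC h -> multiplicative F.
Proof.
have [hM h1] : multiplicative (mmap malgC h : NCSym -> NCSym2).
  by apply: commr_mmap_is_multiplicative => x A B; apply: malgC_comm.
by move=> Fh; split=> [x y|]; rewrite !Fh.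
Qed.

Lemma mmap_additive (h : spart -> NCSym2) (F : NCSym -> NCSym2) :
  F =1 mmap malgC h -> additive F.
Proof. by move=> Fh x y; rewrite !Fh raddfB. Qed.

HB.instance Definition _ := GRing.isAdditive.Build NCSym NCSym2 coprod
  (mmap_additive coprod_mmap).
HB.instance Definition _ := GRing.isMultiplicative.Build NCSym NCSym2 coprod
  (mmap_multiplicative coprod_mmap).
HB.instance Definition _ := GRing.isAdditive.Build NCSym NCSym2 tensor_left
  (mmap_additive tensorx1_mmap).
HB.instance Definition _ := GRing.isMultiplicative.Build NCSym NCSym2 tensor_left
  (@mmap_multiplicative basis_left _ tensorx1_mmap).
HB.instance Definition _ := GRing.isAdditive.Build NCSym NCSym2 tensor_right
  (mmap_additive tensor1x_mmap).
HB.instance Definition _ := GRing.isMultiplicative.Build NCSym NCSym2 tensor_right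
  (@mmap_multiplicative basis_right _ tensor1x_mmap).

Lemma coprodU A : coprod << A >> = coprod_basis A.
Proof. by rewrite coprod_mmap mmapU mul_malgC scale1r. Qed.

Lemma tensor_leftU A : tensor_left << A >> = << (A, spart0) >>.
Proof. by rewrite /tensor_left tensorx1_mmap mmapU mul_malgC scale1r. Qed.

Lemma tensor_rightU A : tensor_right << A >> = << (spart0, A) >>.
Proof. by rewrite /tensor_right tensor1x_mmap mmapU mul_malgC scale1r. Qed.

Lemma tensor_comm x y : GRing.comm (tensor_left x) (tensor_right y).
Proof.
rewrite /tensor_left /tensor_right tensorx1_mmap tensor1x_mmap.
apply/commr_sym/commr_sum => A _; apply/commr_sym/commr_sum => B _.
apply: commrM; first exact/commr_sym/malgC_comm.
apply/commr_sym/commrM; first exact/commr_sym/malgC_comm.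
rewrite /GRing.comm [LHS]malgUM [RHS]malgUM; congr << _ >>.
by congr (_, _); rewrite [LHS](bar0s, bars0) [RHS](bar0s, bars0).
Qed.

(** * The elements p(A) *)

Definition std_fun n (A : setpart n) : setfun 'I_#|A| NCSym :=
  [ffun K : {set 'I_#|A|} => << std_sub K >>].

Lemma std_fun0 n (A : setpart n) : std_fun A set0 = 1.
Proof. by rewrite ffunE std_sub0. Qed.

Lemma comp_actU n (A : setpart n) (g : seq {set 'I_#|A|}) :
  << comp_act g >> = \prod_(K <- g) std_fun A K.
Proof.
rewrite /comp_act; elim: g => [|K g IHg]; first by rewrite !big_nil.
by rewrite !big_cons -IHg ffunE [RHS]malgUM.
Qed.

Lemma pelt_logder n (A : setpart n) (i : 'I_#|A|) : i = 0%N :> nat ->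
  pelt A = logder i (std_fun A) setT.
Proof.
move=> i0; rewrite /logder der_inv_compositions ?std_fun0 //.
apply: eq_big => [g|g _].
  rewrite /first_composition; congr (_ && _).
  apply/existsP/idP => [[k /andP[/eqP k0]]|ig].
    by rewrite (_ : k = i) //; apply: val_inj; rewrite /= k0 i0.
  by exists i; rewrite ig i0 eqxx.
rewrite comp_actU -mul_malgC; congr (_ * _).
by rewrite rmorphXn rmorphN1.
Qed.

Lemma coprod_std_fun n (A : setpart n) :
  smap coprod (std_fun A) =
  smap tensor_left (std_fun A) * smap tensor_right (std_fun A).
Proof.
apply/ffunP=> K; rewrite setfunME ffunE ffunE coprodU coprod_basis_std_sub.
apply: eq_bigr => L _; rewrite !ffunE tensor_leftU tensor_rightU [RHS]malgUM.
by congr << _ >>; congr (_, _); rewrite [RHS](bars0, bar0s).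
Qed.

Lemma ex_part n (A : setpart n) (x : 'I_n) : exists k : 'I_#|A|, x \in part k.
Proof.
have : x \in cover A by rewrite (cover_partition (partsP A)) inE.
by case/bigcupP=> X /part_surj[k ->]; exists k.
Qed.

Lemma parts_gt0 n (A : setpart n) : (0 < n)%N -> (0 < #|A|)%N.
Proof.
by move=> n0; have [[k kA] _] := ex_part A (Ordinal n0); apply: leq_ltn_trans kA.
Qed.

Lemma primitive_pelt n (A : setpart n) : (0 < n)%N -> primitive (pelt A).
Proof.
move=> n0; have A0 := parts_gt0 A n0.
pose i := Ordinal A0; rewrite /primitive (@pelt_logder _ _ i) //.
exact: (logder_primitive i _ (std_fun0 A) tensor_comm (coprod_std_fun A)).
Qed.

(** The parts that come from B partition an initial segment. *)
Lemma bar_not_atomic n (A : setpart n) (B C : spart) :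
  to_spart A = bar B C -> (0 < tag B)%N -> (0 < tag C)%N -> ~~ atomic A.
Proof.
move=> ABC B0 C0.
(* As a function on spart, atomic can be rewritten along an equality between
   partitions of sets of different types. *)
pose at_ (S : spart) := atomic (tagged S).
rewrite -[atomic A]/(at_ (to_spart A)) ABC /at_ /atomic negb_and negbK /=.
apply/orP; right; apply/existsP; set b := tag B; set c := tag C.
exists [set @lshift b c @: X | X : {set 'I_b} in tagged B].
have ltb : (b < b + c)%N by rewrite -ltn_subLR // subnn.
apply/existsP; exists (Ordinal ltb); rewrite subsetUl B0 /=.
have -> : [set i : 'I_(b + c) | (i < b)%N] = @lshift b c @: setT.
  apply/setP=> i; rewrite inE; apply/idP/imsetP => [ib|[j _ ->]].
    by exists (Ordinal ib) => //; apply: val_inj.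
  by rewrite /= ltn_ord.
by rewrite (imset_partition _ _ (@lshift_inj b c)); apply: partsP.
Qed.

Lemma tag_std_sub n (A : setpart n) (K : {set 'I_#|A|}) :
  K != set0 -> (0 < tag (std_sub K))%N.
Proof.
case/set0Pn=> k kK; rewrite /= card_gt0.
have kA := part_in k; have /and3P[_ _ A0] := partsP A.
have /set0Pn[x xk] : part k != set0 by apply: contraNneq A0 => <-.
by apply/set0Pn; exists x; apply/bigcupP; exists (part k); rewrite ?imset_f.
Qed.

Lemma tag_comp_act n (A : setpart n) (g : seq {set 'I_#|A|}) :
  g != [::] -> set0 \notin g -> (0 < tag (comp_act g))%N.
Proof.
case: g => // K g _; rewrite inE negb_or eq_sym => /andP[K0 _].
by rewrite /comp_act big_cons /= ltn_addr // tag_std_sub.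
Qed.

(** Only the composition with one block contributes: any other composition gives
a product of two nonempty partitions. *)
Lemma pelt_coeff n (A : setpart n) : atomic A -> (pelt A)@_(to_spart A) = 1.
Proof.
move=> atA; have n0 : (0 < n)%N by case/andP: atA.
have A0 := parts_gt0 A n0.
have T1 : (size [:: [set: 'I_#|A|]] <= #|A|)%N by [].
pose g1 : #|A|.-bseq {set 'I_#|A|} := Bseq T1.
have T0 : [set: 'I_#|A|] != set0.
  by apply/set0Pn; exists (Ordinal A0); rewrite inE.
rewrite /pelt (bigD1 g1) /=; last first.
  rewrite /first_composition set_composition_cons set_composition_nil T0.
  rewrite subsetT setDv eqxx /=; apply/existsP; exists (Ordinal A0).
  by rewrite inE.
have g1A : comp_act g1 = to_spart A.
  by rewrite /comp_act big_cons big_nil bars0 std_subT.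
rewrite expr0 scale1r mcoeffD g1A mcoeffUU.
rewrite raddf_sum big1 ?addr0 //= => g /andP[/andP[cg fg] ng1].
rewrite mcoeffZ mcoeffU1; case: eqP => gA; last by rewrite mulr0.
case/negP: atA; move: ng1 gA cg; rewrite -val_eqE /=.
case: (g : seq _) fg => [|K [|L h]] fg.
- by case/existsP: fg => i; rewrite inE andbF.
- rewrite set_composition_cons set_composition_nil => ng1 _ /and3P[_ _].
  by rewrite setD_eq0 subTset => /eqP KT; rewrite KT eqxx in ng1.
move=> _ gA /and3P[]; rewrite inE negb_or eq_sym => /andP[K0 h0] _ _.
apply/negP/(@bar_not_atomic _ _ (std_sub K) (comp_act (L :: h))).
- by rewrite -gA /comp_act big_cons.
- exact: tag_std_sub.
- exact: tag_comp_act.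
Qed.

Lemma part_min_le n (X : {set 'I_n}) (x : 'I_n) : x \in X -> (part_min X <= x)%N.
Proof.
rewrite /part_min -big_filter => xX.
have : x \in [seq i <- index_enum 'I_n | i \in X].
  by rewrite mem_filter xX mem_index_enum.
elim: (filter _ _) => // y s IHs.
rewrite big_cons inE geq_min => /orP[/eqP->|/IHs->]; first by rewrite leqnn.
by rewrite orbT.
Qed.

(** This is where the order of the parts by minima matters: it makes the
first part belong to every set of parts whose union is a nonempty initial
segment. *)
Lemma part_first n (A : setpart n) (i : 'I_#|A|) (x : 'I_n) :
  i = 0%N :> nat -> x = 0%N :> nat -> x \in part i.
Proof.
move=> i0 x0; have [k xk] := ex_part A x.
pose le_min (Y Z : {set 'I_n}) := (part_min Y <= part_min Z)%N.
have min_le : le_min (part i) (part k).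
  apply: (@sorted_leq_nth _ le_min); rewrite ?inE ?size_sort -?cardE ?ltn_ord //.
  - by move=> Z Y W; apply: leq_trans.
  - by move=> Y; apply: leqnn.
  - by apply: sort_sorted => Y Z; apply: leq_total.
  - by rewrite i0.
have min0 : part_min (part i) = 0%N.
  apply/eqP; rewrite -leqn0 (leq_trans min_le) //.
  by rewrite -x0 part_min_le.
have [/existsP[y /andP[yi /eqP y0]]|] :=
    boolP [exists y : 'I_n, (y \in part i) && (y == 0%N :> nat)].
  by rewrite (_ : x = y) //; apply: val_inj; rewrite /= x0 y0.
rewrite negb_exists => /forallP all_pos.
have : (0 < part_min (part i))%N; last by rewrite min0.
apply: (big_ind (fun v => 0 < v)%N) => [|u v|y yi].
- exact: leq_ltn_trans (leq0n x) (ltn_ord x).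
- by rewrite leq_min => -> ->.
by move: (all_pos y); rewrite yi lt0n.
Qed.

Lemma mem_initial_part n (A : setpart n) (B : {set {set 'I_n}}) (m : nat) :
  B \subset (A : {set _}) -> cover B = [set x : 'I_n | (x < m)%N] ->
  forall (k : 'I_#|A|) x, x \in part k -> (x < m)%N = (part k \in B).
Proof.
move=> BA cB k x xk; have /and3P[_ /trivIsetP tA _] := partsP A.
apply/idP/idP => [xm|kB]; last first.
  suff : x \in cover B by rewrite cB inE.
  by apply/bigcupP; exists (part k).
have /bigcupP[X XB xX] : x \in cover B by rewrite cB inE.
have [<- //|neX] := eqVneq X (part k).
have /pred0P/(_ x) := tA _ _ (subsetP BA X XB) (part_in k) neX.
by rewrite /= xX xk.
Qed.

(** The parts in B lie below m and the other parts do not, so the standardization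
of A_K is the product of those of its parts in B and of its other parts. In the
convolution product at K only the splitting of K by U survives. *)
Lemma std_fun_factor n (A : setpart n) (B : {set {set 'I_n}}) (m : nat) :
  B \subset (A : {set _}) -> cover B = [set x : 'I_n | (x < m)%N] ->
  let U := [set k : 'I_#|A| | part k \in B] in
  std_fun A = res U (std_fun A) * res (~: U) (std_fun A).
Proof.
move=> BA cB U.
have ltm k x : x \in part k -> (x < m)%N = (k \in U).
  by move=> xk; rewrite inE (mem_initial_part BA cB xk).
apply/ffunP=> K; rewrite setfunME (bigD1 (K :&: U)) ?subsetIl //= big1; last first.
  move=> L /andP[LK /eqP LKU]; rewrite !ffunE.
  case: ifP => LU; last by rewrite mul0r.
  case: ifP => DU; last by rewrite mulr0.
  case: LKU; apply/eqP; rewrite eqEsubset subsetI LK LU /=.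
  apply/subsetP=> k /setIP[kK kU]; apply/negPn/negP=> kL.
  by have := subsetP DU k; rewrite in_setC in_setD kK kL kU => /(_ isT).
rewrite addr0 !ffunE subsetIr.
have -> : K :\: (K :&: U) \subset ~: U.
  by rewrite setDIr setDv set0U setDE subsetIr.
rewrite [RHS]malgUM; congr << _ >>.
have KE : subparts (K :&: U) :|: subparts (K :\: (K :&: U)) = subparts K.
  by rewrite /subparts -imsetU setDIr setDv set0U setID.
rewrite -!std_subE -KE; apply: std_bar; last by rewrite KE; apply: subparts_partition.
move=> x y /bigcupP[_ /imsetP[k kKU ->] xk] /bigcupP[_ /imsetP[l lKU ->] yl].
have kU : k \in U by case/setIP: kKU.
have lU : l \notin U.
  by move: lKU; rewrite setDIr setDv set0U => /setDP[].
by apply: (@leq_trans m); rewrite ?(ltm _ _ xk) // leqNgt (ltm _ _ yl).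
Qed.

Lemma pelt_not_atomic n (A : setpart n) : ~~ atomic A -> pelt A = 0.
Proof.
rewrite /atomic negb_and negbK -leqNgt leqn0 => /orP[/eqP n0|].
  have A0 : #|A| = 0%N.
    apply/eqP; rewrite cards_eq0; apply/eqP; subst n.
    by have := partsP A; have -> : [set: 'I_0] = set0 by [apply/setP=> -[]];
      rewrite partition_set0 => /eqP.
  apply: big_pred0 => g; rewrite /first_composition; apply/andP=> -[_].
  by case/existsP=> k; have := leq_trans (ltn_ord k) (eq_leq A0).
case/existsP=> B /existsP[m /and3P[BA m0 pB]].
have n0 : (0 < n)%N := leq_ltn_trans (leq0n m) (ltn_ord m).
have A0 := parts_gt0 A n0.
pose i := Ordinal A0; rewrite (@pelt_logder _ _ i) //.
have cB := cover_partition pB.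
have XE := std_fun_factor BA cB.
set U := [set k | _] in XE.
have iU : i \in U.
  have xi := @part_first _ A i (Ordinal n0) erefl erefl.
  by rewrite inE -(mem_initial_part BA cB xi).
rewrite -(logder_support (std_fun0 A) iU XE).
rewrite ffunE; case: ifP => // /subsetP TU.
have [k mk] := ex_part A m; have := TU k (in_setT k); rewrite inE => kB.
by rewrite -(mem_initial_part BA cB mk) ltnn in kB.
Qed.

Theorem theorem2 (n : nat) (A : setpart n) :
  (atomic A -> pelt A <> 0 /\ primitive (pelt A)) /\
  (~~ atomic A -> pelt A = 0).
Proof.
split=> [atA|]; last exact: pelt_not_atomic.
split; last by apply: primitive_pelt; case/andP: atA.
move=> pA0; have := pelt_coeff atA; rewrite pA0 mcoeff0 => /eqP.
by rewrite eq_sym oner_eq0.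
Qed.
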